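(* Let $\mathbb{K}\in\{\mathbb{R},\mathbb{C}\}$, let $n\ge 1$ and $d\ge 0$ be integers, let $\theta\in(0,1)$, and let $*$ denote either $d$ or $\le d$. Let $m\ge \dim_{\mathbb{K}} \mathbb{K}[\mathbf{X}]_*$, and let $y_1,\dots,y_m\in\mathbb{K}^n$ be generic. Then $$\mathbb{K}[\mathbf{X}]_* = \operatorname{span}_{\mathbb{K}}\{k_*(y_i,\mathbf{X}) : 1\le i\le m\}.$$
   Context: $\mathbf{X}=(X_1,\dots,X_n)$ is a vector of variables. $\mathbb{K}[\mathbf{X}]_d$ is the $\mathbb{K}$-vector space of homogeneous polynomials of degree $d$ in $\mathbf{X}$ (together with $0$), and $\mathbb{K}[\mathbf{X}]_{\le d}$ is the $\mathbb{K}$-vector space of all polynomials of degree at most $d$ in $\mathbf{X}$. The homogeneous and inhomogeneous polynomial kernels are, for $x,y\in\mathbb{K}^n$, $$k_d(x,y)=\theta^d\langle x,y\rangle^d,\qquad k_{\le d}(x,y)=(\theta\langle x,y\rangle+1)^d,$$ where $\langle x,y\rangle=\sum_{i=1}^n x_iy_i$. For $y\in\mathbb{K}^n$, $k_*(y,\mathbf{X})\in\mathbb{K}[\mathbf{X}]_*$ is the polynomial obtained by substituting the vector of variables $\mathbf{X}$ for the second argument. ''Generic'' means that the assertion holds for all $(y_1,\dots,y_m)\in(\mathbb{K}^n)^m$ outside some proper Zariski-closed subset of $(\mathbb{K}^n)^m$. *)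

(* Defs.v *)
From HB Require Import structures.
From mathcomp Require Import all_boot all_order all_algebra.
From mathcomp Require Import mpoly.
From mathcomp Require Import complex reals.

Set Implicit Arguments.
Unset Strict Implicit.
Unset Printing Implicit Defensive.

Import GRing.Theory.
Local Open Scope ring_scope.

Variant scalar_kind := RealScalars | ComplexScalars.

Definition scalars (R : realType) (F : scalar_kind) : fieldType :=
  match F with RealScalars => R | ComplexScalars => R[i] end.

Definition scalar_of (R : realType) (F : scalar_kind) : R -> scalars R F :=
  match F return R -> scalars R F with
  | RealScalars => fun a => a
  | ComplexScalars => fun a => a%:C%C
  end.

(* The two values, "d" and "<= d", of the subscript "*". *)
Variant degree_kind := Homogeneous | Inhomogeneous.

Section PolySpace.
Variables (K : fieldType) (n : nat) (s : degree_kind) (d : nat).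

(* [0] is [d.-homog], and [msize p] is one more than the total degree of [p]
   (with [msize 0 = 0]), so both spaces contain [0]. *)
Definition in_polys : {pred {mpoly K[n]}} := fun p =>
  match s with
  | Homogeneous => p \is d.-homog
  | Inhomogeneous => (msize p <= d.+1)%N
  end.

Definition mnm_in_polys (m : 'X_{1..n}) : bool :=
  match s with Homogeneous => mdeg m == d | Inhomogeneous => (mdeg m <= d)%N end.

Lemma in_polysP p :
  reflect (forall m, p@_m != 0 -> mnm_in_polys m) (p \in in_polys).
Proof.
rewrite unfold_in /in_polys /mnm_in_polys; case: s; apply: (iffP idP) => h.
- by move=> m; rewrite -mcoeff_msupp => /(elimT (dhomogP _ _ _) h) /eqP.
- by apply/dhomogP => m; rewrite mcoeff_msupp => /h /eqP.
- by move=> m; rewrite -mcoeff_msupp => /msize_mdeg_lt /leq_trans -/(_ _ h).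
- rewrite msizeE; apply/bigmax_leqP_seq => m; rewrite mcoeff_msupp => hm _.
  exact: h.
Qed.

Lemma in_polys_submod_closed : submod_closed in_polys.
Proof.
split=> [|a p q /in_polysP hp /in_polysP hq]; apply/in_polysP => m.
  by rewrite mcoeff0 eqxx.
rewrite mcoeffD mcoeffZ; have [-> | /hp //] := eqVneq p@_m 0.
by rewrite mulr0 add0r => /hq.
Qed.

HB.instance Definition _ :=
  GRing.isSubmodClosed.Build K {mpoly K[n]} in_polys in_polys_submod_closed.

Record polys := Polys { mpoly_of_polys :> {mpoly K[n]};
                        _ : mpoly_of_polys \in in_polys }.

HB.instance Definition _ := [isSub for mpoly_of_polys].
HB.instance Definition _ := [Choice of polys by <:].
HB.instance Definition _ := [SubChoice_isSubLmodule of polys by <:].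

Definition polys_mnms : seq 'X_{1..n} :=
  [seq m <- [seq bmnm b | b <- enum {: 'X_{1..n < d.+1}}] | mnm_in_polys m].

Lemma polys_mnms_uniq : uniq polys_mnms.
Proof. by rewrite filter_uniq // map_inj_uniq ?enum_uniq //; exact: val_inj. Qed.

Lemma mem_polys_mnms m : (m \in polys_mnms) = mnm_in_polys m.
Proof.
rewrite mem_filter andb_idr // => hm.
have lt_md : (mdeg m < d.+1)%N.
  by move: hm; rewrite /mnm_in_polys; case: s => // /eqP ->.
by apply/mapP; exists (BMultinom lt_md) => //; rewrite mem_enum.
Qed.

Lemma polys_vector_axiom : vector_axiom (size polys_mnms) polys.
Proof.
pose M (i : 'I_(size polys_mnms)) := nth 0%MM polys_mnms i.
have M_inj : injective M.
  move=> i j /eqP; rewrite nth_uniq ?polys_mnms_uniq // => /eqP.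
  exact: val_inj.
exists (fun p : polys => \row_i (val p)@_(M i)) => [c p q|].
  by apply/rowP=> i; rewrite !mxE /= mcoeffD mcoeffZ.
pose g (r : 'rV[K]_(size polys_mnms)) : {mpoly K[n]} :=
  \sum_i r 0 i *: 'X_[M i].
have gE r i : (g r)@_(M i) = r 0 i.
  rewrite /g raddf_sum (bigD1 i) //= mcoeffZ mcoeffX eqxx mulr1.
  rewrite big1 ?addr0 // => j ne_ji.
  by rewrite mcoeffZ mcoeffX (inj_eq M_inj) (negbTE ne_ji) mulr0.
have gN r m : ~~ mnm_in_polys m -> (g r)@_m = 0.
  move=> hm; rewrite /g raddf_sum big1 // => j _ /=.
  rewrite mcoeffZ mcoeffX; case: eqP => [eq_m|]; last by rewrite mulr0.
  by case/negP: hm; rewrite -eq_m -mem_polys_mnms mem_nth.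
have g_in r : g r \in in_polys.
  by apply/in_polysP => m; apply: contraR => /gN ->.
exists (fun r => Polys (g_in r)) => [p | r]; last first.
  by apply/rowP=> i; rewrite mxE /= gE.
apply/val_inj/mpolyP=> m /=; case: (boolP (mnm_in_polys m)) => hm; last first.
  rewrite gN //; apply/esym/eqP; apply: contraR hm.
  by move/in_polysP: (valP p); apply.
have lt_i : (index m polys_mnms < size polys_mnms)%N.
  by rewrite index_mem mem_polys_mnms.
have mE : m = M (Ordinal lt_i) by rewrite /M nth_index // mem_polys_mnms.
by rewrite {1}mE gE mxE -mE.
Qed.

HB.instance Definition _ :=
  Lmodule_hasFinDim.Build K polys polys_vector_axiom.

End PolySpace.

(* The ring [A] is [K] for the kernel as a function on [K^n], and
   [{mpoly K[n]}] when variables are substituted for an argument. *)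
Definition kernel (A : comNzRingType) (n : nat) (s : degree_kind) (d : nat)
    (theta : A) (x y : 'I_n -> A) : A :=
  match s with
  | Homogeneous => theta ^+ d * (\sum_i x i * y i) ^+ d
  | Inhomogeneous => (theta * (\sum_i x i * y i) + 1) ^+ d
  end.

Section KernelPoly.
Variables (K : fieldType) (n : nat) (s : degree_kind) (d : nat) (theta : K).

Definition kernel_mpoly (y : 'rV[K]_n) : {mpoly K[n]} :=
  kernel s d theta%:MP (fun i => (y 0 i)%:MP) (fun i => 'X_i).

Lemma kernel_mpoly_eval (x y : 'rV[K]_n) :
  (kernel_mpoly y).@[x 0] = kernel s d theta (y 0) (x 0).
Proof.
have sE : (\sum_i (y 0 i)%:MP_[n] * 'X_i).@[x 0] = \sum_i y 0 i * x 0 i.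
  rewrite raddf_sum; apply: eq_bigr => i _ /=.
  by rewrite mevalM mevalC mevalXU.
rewrite /kernel_mpoly /kernel; case: s.
  by rewrite mevalM !rmorphXn /= mevalC sE.
by rewrite rmorphXn /= mevalD mevalM mevalC meval1 sE.
Qed.

Lemma kernel_mpoly_in (y : 'rV[K]_n) : kernel_mpoly y \in in_polys s d.
Proof.
have hs : \sum_i (y 0 i)%:MP_[n] * 'X_i \is 1.-homog.
  apply: rpred_sum => i _; rewrite mul_mpolyC rpredZ //.
  by rewrite dhomogX /= mdeg1.
rewrite unfold_in /in_polys /kernel_mpoly /kernel; case: s.
  rewrite -rmorphXn /= mul_mpolyC rpredZ //.
  by have := dhomogMn d hs; rewrite mul1n.
have hl : (msize (theta%:MP * (\sum_i (y 0 i)%:MP_[n] * 'X_i) + 1) <= 2)%N.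
  rewrite msizeE; apply/bigmax_leqP_seq => m hm _.
  have := msuppD_le hm; rewrite mem_cat mul_mpolyC => /orP[/msuppZ_le|].
    by move=> /(elimT (dhomogP _ _ _) hs) ->.
  by rewrite msupp1 inE => /eqP ->; rewrite mdeg0.
elim: d => [|k IHk]; first by rewrite expr0 msize1.
rewrite exprS msizeE; apply/bigmax_leqP_seq => m /msuppM_le.
case/allpairsP => -[m1 m2] [/= h1 h2 ->] _; rewrite mdegD.
have {}h1 := leq_trans (msize_mdeg_lt h1) hl.
have {}h2 := leq_trans (msize_mdeg_lt h2) IHk.
by rewrite ltnS -add1n; apply: leq_add; rewrite -ltnS.
Qed.

Definition kernel_poly (y : 'rV[K]_n) : polys K n s d :=
  Polys (kernel_mpoly_in y).

End KernelPoly.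

Section Generic.
Variables (K : fieldType) (m n : nat).

(* A matrix in ['M[K]_(m, n)] stands for the [m]-tuple of its rows, a point of
   [(K^n)^m]; polynomials on this space have [m * n] variables, evaluated at
   the entries of the matrix listed by [mxvec]. *)
Definition zariski_closed (Z : 'M[K]_(m, n) -> Prop) : Prop :=
  exists S : {mpoly K[m * n]} -> Prop,
    forall y, Z y <-> (forall p, S p -> p.@[mxvec y 0] = 0).

Definition generically (P : 'M[K]_(m, n) -> Prop) : Prop :=
  exists Z : 'M[K]_(m, n) -> Prop,
    [/\ zariski_closed Z, exists y, ~ Z y & forall y, ~ Z y -> P y].

End Generic.

(* Main.v *)
(* Every monomial X^mu of K[X]_* occurs in k_*(y, X) with coefficient c_mu y^mu,
   where c_mu <> 0 depends only on mu. So the kernels at y_1, ..., y_N, with N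
   the dimension of K[X]_*, span as soon as the N x N matrix (y_i^mu) is
   invertible, and its determinant is a polynomial in the y_i. That polynomial
   is not zero: at y_i = (x_1^i, ..., x_n^i) the matrix is the Vandermonde
   matrix of the values x^mu, which are distinct for x_l = 2 ^ ((d + 1) ^ l). *)
Require Import Defs.
From HB Require Import structures.
From mathcomp Require Import all_boot all_order all_algebra.
From mathcomp Require Import mpoly.
From mathcomp Require Import ring complex reals.

Set Implicit Arguments.
Unset Strict Implicit.
Unset Printing Implicit Defensive.

Import GRing.Theory.
Local Open Scope ring_scope.

(* The multinomial coefficient is expressed as the number of maps
   f : 'I_k -> 'I_n with fibres of the cardinalities prescribed by mu. *)
Lemma mcoeff_exp_linear (K : fieldType) n k (y : 'I_n -> K) (mu : 'X_{1..n}) :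
  ((\sum_i (y i)%:MP * 'X_i) ^+ k)@_mu =
  #|[set f : {ffun 'I_k -> 'I_n} | (\sum_j U_(f j))%MM == mu]|%:R *
    \prod_i y i ^+ mu i.
Proof.
have XS (f : {ffun 'I_k -> 'I_n}) :
    \prod_j 'X_(f j) = 'X_[\sum_j U_(f j)] :> {mpoly K[n]}.
  by rewrite (big_morph (fun m => 'X_[m]) (@mpolyXD _ _) (@mpolyX0 _ _)).
rewrite -{1}[k]card_ord -prodr_const bigA_distr_bigA raddf_sum /=.
under eq_bigr => f _.
  rewrite big_split /= XS -rmorph_prod /= mcoeffCM mcoeffX.
  (* Both sides are the value at [y] of the monomial [\prod_j 'X_(f j)]. *)
  have -> : \prod_j y (f j) = \prod_i y i ^+ (\sum_j U_(f j))%MM i.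
    rewrite -mevalX -XS rmorph_prod /=.
    by apply: eq_bigr => j _; rewrite mevalXU.
  rewrite mulr_natr mulrb.
  over.
rewrite -big_mkcond /= -sum1dep_card natr_sum mulr_suml.
by apply: eq_bigr => f /eqP ->; rewrite mul1r.
Qed.

(** Listing the variables of [mu] with multiplicity gives [f]; hence the multinomial count for
    [k = mdeg mu] is positive. *)
Lemma mdeg_sum_mnm1 n (mu : 'X_{1..n}) :
  exists f : {ffun 'I_(mdeg mu) -> 'I_n}, (\sum_j U_(f j))%MM = mu.
Proof.
have /eqP sz := size_m2s mu; exists [ffun j => tnth (Tuple sz) j].
under eq_bigr do rewrite ffunE.
rewrite -(big_tuple _ _ (Tuple sz) xpredT (fun i => U_(i)%MM)) /=.
rewrite -[RHS]s2mK; apply/mnmP => i; rewrite mnm_sumE mnmE -sum1_count.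
by rewrite [RHS]big_mkcond /=; apply: eq_bigr => j _; rewrite mnm1E; case: eqP.
Qed.

(** The constant is a power of [theta] times a multinomial coefficient, and in the inhomogeneous
    case also a binomial one; characteristic 0 keeps these integers nonzero in [K]. *)
Lemma mcoeff_kernel_mpoly (K : fieldType) n s d (theta : K) (mu : 'X_{1..n}) :
  [pchar K] =i pred0 -> theta != 0 -> mnm_in_polys s d mu ->
  exists2 c, c != 0 &
    forall y, (kernel_mpoly s d theta y)@_mu = c * \prod_i y 0 i ^+ mu i.
Proof.
move=> K0 theta0 mu_in.
pose N k := #|[set f : {ffun 'I_k -> 'I_n} | (\sum_j U_(f j))%MM == mu]|.
have N0 : (N (mdeg mu))%:R != 0 :> K.
  rewrite (pcharf0P _).1 // -lt0n; apply/card_gt0P.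
  by have [f fE] := mdeg_sum_mnm1 mu; exists f; rewrite inE fE.
have NE k : k != mdeg mu -> N k = 0%N.
  move=> ne; apply/eqP; rewrite cards_eq0; apply/eqP/setP => f; rewrite !inE.
  apply: contra_neqF ne => /eqP <-; rewrite mdeg_sum.
  by under eq_bigr do rewrite mdeg1; rewrite sum1_card card_ord.
case: s mu_in => /= [/eqP mu_d | mu_d].
  exists (theta ^+ d * (N d)%:R) => [|y].
    by rewrite mulf_neq0 ?expf_neq0 // -mu_d.
  by rewrite /kernel_mpoly /kernel -rmorphXn mcoeffCM mcoeff_exp_linear mulrA.
exists (theta ^+ mdeg mu * (N (mdeg mu))%:R * 'C(d, mdeg mu)%:R) => [|y].
  by rewrite !mulf_neq0 ?expf_neq0 // (pcharf0P _).1 // -lt0n bin_gt0.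
rewrite /kernel_mpoly /kernel addrC exprDn raddf_sum /=.
(* By degree, only the binomial term of index [mdeg mu] contains the monomial [mu]. *)
rewrite (bigD1 (Ordinal (mu_d : (mdeg mu < d.+1)%N))) //=.
rewrite [X in _ + X]big1 ?addr0.
  rewrite expr1n mul1r mcoeffMn exprMn -rmorphXn mcoeffCM mcoeff_exp_linear.
  by rewrite -/(N _) -mulr_natr; ring.
move=> i ne; rewrite expr1n mul1r mcoeffMn exprMn -rmorphXn mcoeffCM.
by rewrite mcoeff_exp_linear -/(N _) NE // mul0r mulr0 mul0rn.
Qed.

(** Uniqueness of base [b] digits: reduction modulo [b] isolates the digit at [ord0], and division
    by [b] leaves the others to the induction. *)
Lemma base_expansion_inj n b (u v : 'I_n -> nat) :
  (forall i, u i < b)%N -> (forall i, v i < b)%N ->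
  (\sum_i u i * b ^ i = \sum_i v i * b ^ i)%N -> u =1 v.
Proof.
elim: n u v => [|n IHn] u v ub vb; first by move=> _ [].
have b0 : (0 < b)%N by exact: leq_ltn_trans (ub ord0).
have E (w : 'I_n.+1 -> nat) : (\sum_i w i * b ^ i =
    (\sum_(i < n) w (lift ord0 i) * b ^ i) * b + w ord0)%N.
  rewrite big_ord_recl muln1 addnC big_distrl; congr (_ + _)%N.
  by apply: eq_bigr => i _ /=; rewrite -mulnA -expnSr.
rewrite !E => eq_uv.
have eq0 : u ord0 = v ord0.
  by have := congr1 (modn^~ b) eq_uv; rewrite !modnMDl !modn_small.
move/eqP: eq_uv; rewrite eq0 eqn_add2r eqn_pmul2r // => /eqP eqS.
have {}IHn := IHn _ _ (fun=> ub _) (fun=> vb _) eqS.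
by move=> i; case: (unliftP ord0 i) => [j|] ->; rewrite ?eq0 ?IHn.
Qed.

(** The ring is arbitrary so that the points may have entries in [K] or be vectors of variables; in
    the latter case the determinant is a polynomial. *)
Definition monomial_mx (A : comNzRingType) n k (M : 'I_k -> 'X_{1..n})
    (z : 'I_k -> 'I_n -> A) : 'M[A]_k :=
  \matrix_(i, j) \prod_l z i l ^+ M j l.

Lemma natr_inj_pchar0 (K : fieldType) :
  [pchar K] =i pred0 -> injective (fun k => k%:R : K).
Proof.
move=> /pcharf0P K0 i j /eqP; wlog le_ij : i j / (i <= j)%N => [hw|].
  case/orP: (leq_total i j) => [/hw//|/hw h]; rewrite eq_sym => /h ->//.
rewrite eq_sym -subr_eq0 -natrB // K0 subn_eq0 => le_ji.
by apply/eqP; rewrite eqn_leq le_ij.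
Qed.

Lemma monomial_mx_regular (K : fieldType) n k (M : 'I_k -> 'X_{1..n}) d :
  [pchar K] =i pred0 -> injective M -> (forall j, (mdeg (M j) <= d)%N) ->
  exists z : nat -> 'I_n -> K, \det (monomial_mx M z) != 0.
Proof.
move=> K0 M_inj M_d; pose x l : K := (2 ^ d.+1 ^ l)%:R.
exists (fun i l => x l ^+ i).
(* The value of the monomial [M j] at [x]: the exponent of 2 has the entries of [M j] as base [d.+1]
   digits. *)
pose a := \row_j (2 ^ \sum_l M j l * d.+1 ^ l)%N%:R : 'rV[K]_k.
have -> : monomial_mx M (fun i l => x l ^+ i) = Vandermonde k a.
  apply/matrixP => i j; rewrite !mxE expn_sum natr_prod -prodrXl.
  by apply: eq_bigr => l _; rewrite exprAC -natrX -expnM mulnC.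
rewrite det_Vandermonde; apply/prodf_neq0 => i _; apply/prodf_neq0 => j lt_ij.
rewrite !mxE subr_eq0; apply: contraTneq lt_ij => /(natr_inj_pchar0 K0)/eqP.
rewrite eqn_exp2l // => /eqP eq_ji.
have M_lt r l : (M r l < d.+1)%N.
  by rewrite ltnS (leq_trans _ (M_d r)) // mdegE (bigD1 l) //= leq_addr.
rewrite (M_inj j i) ?ltnn //; apply/mnmP.
exact: base_expansion_inj (M_lt j) (M_lt i) eq_ji.
Qed.

(** The first N kernels already suffice: matching the coefficients of [p] is a linear system with
    matrix [A], up to the nonzero factors [c j]. *)
Lemma kernel_poly_span (K : fieldType) n s d (theta : K) m
    (M := nth 0%MM (polys_mnms n s d))
    (le_m : (size (polys_mnms n s d) <= m)%N) (y : 'M[K]_(m, n)) :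
  [pchar K] =i pred0 -> theta != 0 ->
  \det (monomial_mx (fun j => M j) (fun i => y (widen_ord le_m i))) != 0 ->
  (fullv : {vspace polys K n s d}) =
    <<[seq kernel_poly s d theta (row i y) | i : 'I_m]>>%VS.
Proof.
move=> K0 theta0; set A := monomial_mx _ _ => detA.
have A_unit : A \in unitmx by rewrite unitmxE unitfE.
have M_in j : (j < size (polys_mnms n s d))%N -> mnm_in_polys s d (M j).
  by move=> lt_j; rewrite -mem_polys_mnms mem_nth.
apply/eqP; rewrite eq_sym eqEsubv subvf /=; apply/subvP => p _.
(* The property is stated as a boolean so that [xchoose] can select the constants. *)
have c_ex (j : 'I_(size (polys_mnms n s d))) : exists c, (c != 0) &&
    [forall i, (kernel_poly s d theta (row i y) : {mpoly K[n]})@_(M j) ==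
       c * \prod_l y i l ^+ M j l].
  have [c c0 cE] := mcoeff_kernel_mpoly K0 theta0 (M_in j (ltn_ord j)).
  exists c; rewrite c0; apply/forallP => i; apply/eqP; rewrite /= cE.
  by congr (_ * _); apply: eq_bigr => l _; rewrite mxE.
pose c j := xchoose (c_ex j).
pose w := \row_j ((val p)@_(M j) / c j) *m invmx A.
suff -> : p = \sum_i w 0 i *: kernel_poly s d theta (row (widen_ord le_m i) y).
  apply: memv_suml => i _; apply/memvZ/memv_span/mapP.
  by exists (widen_ord le_m i); rewrite ?mem_enum.
apply/val_inj/mpolyP => mu; rewrite [in RHS]raddf_sum raddf_sum /=.
(* Outside the monomials of the space both coefficients vanish; inside, [w *m A] gives the
   equality. *)
have [mu_in|mu_out] := boolP (mnm_in_polys s d mu); last first.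
  have z (q : polys K n s d) : (val q)@_mu = 0.
    by apply/eqP; apply: contraR mu_out; move/in_polysP: (valP q); apply.
  rewrite [LHS]z big1 // => i _.
  by rewrite mcoeffZ (_ : _@__ = 0) ?mulr0 //; exact: (z (kernel_poly _ _ _ _)).
have lt_j : (index mu (polys_mnms n s d) < size (polys_mnms n s d))%N.
  by rewrite index_mem mem_polys_mnms.
pose j := Ordinal lt_j.
have -> : mu = M j by rewrite /M nth_index // mem_polys_mnms.
have /andP[cj0 /forallP cE] := xchooseP (c_ex j); rewrite -/(c j) in cj0 cE.
have wA : (w *m A) 0 j = (val p)@_(M j) / c j.
  by rewrite /w mulmxKV // mxE.
rewrite -[LHS](divfK cj0) -wA mxE mulr_suml.
apply: eq_bigr => i _; rewrite mcoeffZ (eqP (cE _)) !mxE.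
by rewrite -mulrA [X in _ * X]mulrC.
Qed.

Lemma kernel_poly_span_generic (K : fieldType) n s d (theta : K) m :
  [pchar K] =i pred0 -> theta != 0 ->
  (\dim {: polys K n s d} <= m)%N ->
  generically (fun y : 'M[K]_(m, n) =>
    (fullv : {vspace polys K n s d}) =
    <<[seq kernel_poly s d theta (row i y) | i : 'I_m]>>%VS).
Proof.
move=> K0 theta0; rewrite dimvf => le_m.
(* The dimension is convertible to this size, by the vector space instance on [polys]. *)
have {}le_m : (size (polys_mnms n s d) <= m)%N by exact: le_m.
pose M (j : 'I_(size (polys_mnms n s d))) := nth 0%MM (polys_mnms n s d) j.
pose X (i : 'I_(size (polys_mnms n s d))) l : {mpoly K[m * n]} :=
  'X_(mxvec_index (widen_ord le_m i) l).
have evalE (y : 'M[K]_(m, n)) : (\det (monomial_mx M X)).@[mxvec y 0] =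
    \det (monomial_mx M (fun i => y (widen_ord le_m i))).
  rewrite -det_map_mx; congr (\det _); apply/matrixP => i j; rewrite !mxE.
  rewrite rmorph_prod; apply: eq_bigr => l _.
  by rewrite rmorphXn /= mevalXU mxvecE.
exists (fun y => (\det (monomial_mx M X)).@[mxvec y 0] = 0); split.
(* The closed set is the zero locus of the single polynomial [\det (monomial_mx M X)]. *)
- by exists (eq (\det (monomial_mx M X))) => y; split=> [h _ <- //|]; apply.
- have M_inj : injective M.
    move=> i j /eqP; rewrite nth_uniq ?polys_mnms_uniq // => /eqP.
    exact: val_inj.
  have M_d j : (mdeg (M j) <= d)%N.
    have : M j \in polys_mnms n s d by rewrite mem_nth.
    by rewrite mem_polys_mnms; case: (s) => //= /eqP ->.
  have [z z0] := monomial_mx_regular K0 M_inj M_d.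
  (* Since [z] is indexed by all of [nat], it also fills the rows beyond the first N. *)
  exists (\matrix_(i, l) z i l); apply/eqP; rewrite evalE.
  suff -> : monomial_mx M (fun i => (\matrix_(i, l) z i l) (widen_ord le_m i))
     = monomial_mx M (fun i => z i) by [].
  apply/matrixP => i j; rewrite !mxE.
  by apply: eq_bigr => l _; rewrite mxE.
- by move=> y /eqP; rewrite evalE; exact: kernel_poly_span.
Qed.

Theorem theorem1 (R : realType) (F : scalar_kind) (n d : nat) (theta : R)
  (s : degree_kind) (m : nat)
  (n_ge1 : (1 <= n)%N) (theta_in01 : 0 < theta < 1)
  (m_ge : (\dim {: polys (scalars R F) n s d} <= m)%N) :
  generically (fun y : 'M[scalars R F]_(m, n) =>
    (fullv : {vspace polys (scalars R F) n s d}) =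
    <<[seq kernel_poly s d (scalar_of F theta) (row i y) | i : 'I_m]>>%VS).
Proof.
have theta0 : theta != 0 by case/andP: theta_in01 => /Num.Theory.lt0r_neq0.
apply: kernel_poly_span_generic m_ge.
- by case: F;
    [exact: (Num.Theory.pchar_num R) | exact: (Num.Theory.pchar_num R[i])].
- by case: F => //=; rewrite fmorph_eq0.
Qed.
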